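(* Let $M\in\mathbb{C}$ satisfy $\Re M>0$, and let $$b_0=0,\qquad b_{2n-1}=M+1,\qquad b_{2n}=\frac{M}{n^2},\qquad n\in\{1,2,3,\ldots\}.$$ Then the continued fraction $\mathop{\mathbf{K}}_{n=1}^{\infty}\frac{1}{b_n}$ converges and $$2M\,\Phi(-1,2,M+1)=\mathop{\mathbf{K}}_{n=1}^{\infty}\frac{1}{b_n}.$$
   Context: The Lerch transcendent is $\Phi(z,s,a)=\sum_{n=0}^{\infty}\frac{z^n}{(n+a)^s}$ for $a\notin\{0,-1,-2,\ldots\}$; in particular $\Phi(-1,2,M+1)=\sum_{n=0}^\infty \frac{(-1)^n}{(n+M+1)^2}$. For complex sequences $(a_n)_{n\ge1}$, $(b_n)_{n\ge 0}$, the continued fraction $b_0+\mathop{\mathbf{K}}_{n=1}^{\infty}\frac{a_n}{b_n}=b_0+\cfrac{a_1}{b_1+\cfrac{a_2}{b_2+\cdots}}$ has convergents $f_n=A_n/B_n$, where $A_{-1}=1$, $A_0=b_0$, $B_{-1}=0$, $B_0=1$, and $A_n=b_nA_{n-1}+a_nA_{n-2}$, $B_n=b_nB_{n-1}+a_nB_{n-2}$ for $n\ge1$. The continued fraction converges, with value $f$, if $\lim_{n\to\infty}f_n=f$ exists. Here all partial numerators are $a_n=1$. *)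

(* Defs.v *)
(* Stdlib reals, with Coquelicot's complex numbers. *)
From Stdlib Require Import Reals.
From Coquelicot Require Import Coquelicot.

Open Scope C_scope.

Definition is_C_lim_seq (u : nat -> C) (l : C) : Prop :=
  filterlim u eventually (locally l).

(* Total: unspecified when [u] diverges; see [is_C_lim_seq_unique]. *)
Definition C_Lim_seq (u : nat -> C) : C :=
  lim (T := C_CompleteNormedModule) (filtermap u eventually).

Lemma is_C_lim_seq_unique (u : nat -> C) (l : C) :
  is_C_lim_seq u l -> C_Lim_seq u = l.
Proof.
intros H.
assert (PF : ProperFilter (filtermap u eventually)).
{ apply filtermap_proper_filter, eventually_filter. }
symmetry.
refine (@filterlim_locally_unique _ C_AbsRing C_NormedModule
          eventually _ u l (C_Lim_seq u) H _).
apply filterlim_locally; intros eps.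
refine (complete_cauchy (T := C_CompleteNormedModule) (filtermap u eventually) PF _ eps).
intros e; exists l.
exact (proj1 (filterlim_locally (U := C_UniformSpace) u l) H e).
Qed.

Definition C_Series (a : nat -> C) : C := C_Lim_seq (sum_n a).

(* The Lerch transcendent Phi(z,s,a), restricted to exponents s in nat, for
   which no branch of the power has to be chosen. *)
Definition lerch (z : C) (s : nat) (a : C) : C :=
  C_Series (fun n => z ^ n / (INR n + a) ^ s).

(* Canonical numerators A_n and denominators B_n of b_0 + K(a_n / b_n).  The
   inner [match] supplies A_{-1} = 1 and B_{-1} = 0; [a 0] is never used. *)
Fixpoint cf_num (a b : nat -> C) (n : nat) : C :=
  match n with
  | O => b O
  | S p => b n * cf_num a b p
           + a n * match p with O => 1 | S q => cf_num a b q end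
  end.

Fixpoint cf_den (a b : nat -> C) (n : nat) : C :=
  match n with
  | O => 1
  | S p => b n * cf_den a b p
           + a n * match p with O => 0 | S q => cf_den a b q end
  end.

Definition cf_convergent (a b : nat -> C) (n : nat) : C :=
  cf_num a b n / cf_den a b n.

(* Division is total, so a finite limit of the convergents f_n = A_n / B_n only
   has its usual meaning once f_n is eventually defined, i.e. B_n <> 0. *)
Definition is_cf (a b : nat -> C) (f : C) : Prop :=
  eventually (fun n => cf_den a b n <> 0) /\
  is_C_lim_seq (cf_convergent a b) f.

Definition ex_cf (a b : nat -> C) : Prop := exists f : C, is_cf a b f.

Definition CF (a b : nat -> C) : C := C_Lim_seq (cf_convergent a b).

(* Main.v *)
Require Import Defs.
From Stdlib Require Import Reals Lra Lia.
From Coquelicot Require Import Coquelicot.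

(** Write B_n for the canonical denominators of the continued fraction with
    parameter M, f_n for its convergents, and B'_n, f'_n for the same objects
    with M + 1 in place of M.

    Put S(M) = Phi(-1,2,M+1).  Shifting the summation index gives
    S(M) + S(M+1) = 1/(M+1)^2, and S is the only solution of this equation
    that tends to 0 along M, M+1, M+2, ...  So it is enough to show that the
    value f(M) of the continued fraction makes R(M) = f(M)/(2M) a solution
    that tends to 0.

    The functional equation holds already for the even convergents, up to an
    explicit error (lemma [shift_even_convergents]):
      f_{2n}/(2M) + f'_{2n}/(2(M+1)) = 1/(M+1)^2 - 1/((M+1)^2 B_{2n} B'_{2n}).
    The reason is that a 2 x 2 matrix, polynomial in n and rational in M,
    carries the solutions of the recurrence for M + 1 to those for M
    ([contiguous_relations]); it maps the pair of B' to that of B, and the pair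
    of A' to a combination of those of A and B, so the identity is the
    determinant formula A_{2n+1} B_{2n} - A_{2n} B_{2n+1} = 1 in disguise.

    Convergence is van Vleck's argument.  All b_n with n >= 1 have positive real
    part, so g_n = Re (B_{n+1} conj B_n) increases, with increments
    Re(b_{n+2}) |B_{n+1}|^2; and all b_{2n} lie on the ray through M, so that
    |b_{2n}| = (|M| / Re M) Re b_{2n}.  Hence |f_{2n+2} - f_{2n}| is at most a
    constant times 1/g_{2n} - 1/g_{2n+2}, which telescopes: f_{2n} converges,
    with an explicit bound on the limit ([even_convergents_bounded_limit]).
    Moreover g_{2n} tends to infinity at least like the harmonic series, so the
    odd convergents have the same limit.

    The error term tends to 0 ([shift_gap_vanishes]): it converges since all the
    other terms of the identity do.  The contiguous relations give
    |B'_{2n}| >= (n+1) |B_{2n}| / |M+1|, so a nonzero limit would force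
    |B_{2n}|^2 = O(1/n); then 1/g_{2n} - 1/g_{2n+2} would be at least a multiple
    of 1/n, which is impossible for a bounded telescoping sum. *)

Open Scope C_scope.

(** * Limits of complex sequences *)

Lemma is_C_lim_seq_Cmod (u : nat -> C) (l : C) :
  is_C_lim_seq u l <-> is_lim_seq (fun n => Cmod (u n - l)) 0.
Proof.
split; intros H.
- apply is_lim_seq_spec; intros eps.
  pose proof (proj1 (@filterlim_locally_ball_norm C_AbsRing nat C_NormedModule
    eventually _ u l) H eps) as [N HN].
  exists N; intros n Hn; specialize (HN n Hn).
  rewrite Rminus_0_r, Rabs_pos_eq by apply Cmod_ge_0.
  exact HN.
- apply (@filterlim_locally_ball_norm C_AbsRing nat C_NormedModule eventually _ u l).
  intros eps.
  apply is_lim_seq_spec in H; destruct (H eps) as [N HN].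
  exists N; intros n Hn; specialize (HN n Hn).
  rewrite Rminus_0_r, Rabs_pos_eq in HN by apply Cmod_ge_0.
  exact HN.
Qed.

Lemma is_C_lim_seq_le (u : nat -> C) (l : C) (e : nat -> R) :
  (forall n, (Cmod (u n - l) <= e n)%R) -> is_lim_seq e 0 -> is_C_lim_seq u l.
Proof.
intros H He; apply is_C_lim_seq_Cmod.
apply is_lim_seq_le_le with (fun _ => 0%R) e; [ | apply is_lim_seq_const | exact He].
intros n; split; [apply Cmod_ge_0 | apply H].
Qed.

Lemma is_C_lim_seq_lin (u v : nat -> C) (l k a b c : C) :
  is_C_lim_seq u l -> is_C_lim_seq v k ->
  is_C_lim_seq (fun n => a + b * u n + c * v n) (a + b * l + c * k).
Proof.
intros Hu Hv.
apply is_C_lim_seq_Cmod in Hu; apply is_C_lim_seq_Cmod in Hv.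
apply is_C_lim_seq_le
  with (fun n => Cmod b * Cmod (u n - l) + Cmod c * Cmod (v n - k))%R.
- intros n.
  replace (a + b * u n + c * v n - (a + b * l + c * k))
    with (b * (u n - l) + c * (v n - k)) by ring.
  rewrite <- !Cmod_mult; apply Cmod_triangle.
- replace (Finite 0) with (Finite (Cmod b * 0 + Cmod c * 0)) by (f_equal; ring).
  apply is_lim_seq_plus';
    apply (is_lim_seq_scal_l _ _ (Finite 0)); assumption.
Qed.

Lemma is_C_lim_seq_incr_1 (u : nat -> C) (l : C) :
  is_C_lim_seq (fun n => u (S n)) l -> is_C_lim_seq u l.
Proof.
intros H; apply is_C_lim_seq_Cmod; apply is_C_lim_seq_Cmod in H.
now apply is_lim_seq_incr_1.
Qed.

Lemma is_C_lim_seq_even_odd (u : nat -> C) (l : C) :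
  is_C_lim_seq (fun n => u (2 * n)%nat) l ->
  is_C_lim_seq (fun n => u (S (2 * n))) l ->
  is_C_lim_seq u l.
Proof.
intros H0 H1; intros P HP.
destruct (H0 P HP) as [N0 HN0]; destruct (H1 P HP) as [N1 HN1].
exists (2 * N0 + 2 * N1)%nat; intros n Hn.
destruct (Nat.Even_or_Odd n) as [[k Hk] | [k Hk]]; subst n.
- apply HN0; lia.
- replace (2 * k + 1)%nat with (S (2 * k)) in * by lia. apply HN1; lia.
Qed.

(** The increments are dominated by a telescoping series of nonnegative terms,
    whose sum is at most [g 0]; this also controls the limit. *)
Lemma is_C_lim_seq_bounded_variation (f : nat -> C) (g : nat -> R) :
  (forall n, (0 <= g n)%R) ->
  (forall n, (Cmod (f (S n) - f n) <= g n - g (S n))%R) ->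
  exists l, is_C_lim_seq f l /\ (Cmod (l - f 0%nat) <= g 0%nat)%R.
Proof.
intros Hg Hf.
assert (Hb : ex_series (fun n => g n - g (S n))%R).
{ assert (Hs : forall n, sum_n (fun n => g n - g (S n))%R n = (g 0%nat - g (S n))%R).
  { induction n as [|n IH]; [now rewrite sum_O|].
    rewrite sum_Sn, IH; unfold plus; simpl; ring. }
  apply (ex_finite_lim_seq_incr _ (g 0%nat)).
  - intros n; rewrite !Hs.
    pose proof (Hf (S n)); pose proof (Cmod_ge_0 (f (S (S n)) - f (S n))); lra.
  - intros n; rewrite Hs; specialize (Hg (S n)); lra. }
destruct (@ex_series_le C_AbsRing C_CompleteNormedModule
  (fun n => f (S n) - f n) (fun n => g n - g (S n))%R Hf Hb) as [s Hs].
assert (Hl : is_C_lim_seq f (s + f 0%nat)).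
{ apply is_C_lim_seq_incr_1, is_C_lim_seq_Cmod.
  apply is_lim_seq_ext with
    (fun n => Cmod (sum_n (fun n => f (S n) - f n) n - s)).
  - intros n.
    assert (E : sum_n (fun n => f (S n) - f n) n = f (S n) - f 0%nat).
    { induction n as [|n IH]; [now rewrite sum_O|].
      rewrite sum_Sn, IH.
      change (f (S n) - f 0%nat + (f (S (S n)) - f (S n)) = f (S (S n)) - f 0%nat); ring. }
    rewrite E; f_equal; ring.
  - apply is_C_lim_seq_Cmod; exact Hs. }
exists (s + f 0%nat); split; [exact Hl|].
assert (Hn : forall n, (Cmod (f n - f 0%nat) <= g 0%nat - g n)%R).
{ induction n as [|n IH].
  - replace (f 0%nat - f 0%nat) with (RtoC 0) by ring; rewrite Cmod_0; lra.
  - replace (f (S n) - f 0%nat) with ((f (S n) - f n) + (f n - f 0%nat)) by ring.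
    pose proof (Cmod_triangle (f (S n) - f n) (f n - f 0%nat)).
    specialize (Hf n); lra. }
apply is_C_lim_seq_Cmod in Hl.
set (l := s + f 0%nat) in *.
apply (is_lim_seq_le (fun _ => Cmod (l - f 0%nat))
  (fun n => Cmod (f n - l) + g 0%nat)%R (Cmod (l - f 0%nat)) (g 0%nat)).
- intros n.
  replace (l - f 0%nat) with (- (f n - l) + (f n - f 0%nat)) by ring.
  pose proof (Cmod_triangle (- (f n - l)) (f n - f 0%nat)) as T.
  rewrite Cmod_opp in T; specialize (Hn n); specialize (Hg n); lra.
- apply is_lim_seq_const.
- replace (Finite (g 0%nat)) with (Finite (0 + g 0%nat)) by (f_equal; ring).
  apply is_lim_seq_plus'; [exact Hl | apply is_lim_seq_const].
Qed.

(** Comparison with [k * ln n]: the increments of the logarithm satisfy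
    [ln (n + 2) - ln (n + 1) <= 1 / (n + 1)]. *)
Lemma is_lim_seq_harmonic_increments (u : nat -> R) (k : R) (N : nat) :
  (0 < k)%R ->
  (forall n, (N <= n)%nat -> (k / INR (S n) <= u (S n) - u n)%R) ->
  is_lim_seq u p_infty.
Proof.
intros Hk Hu.
assert (Hln : forall n, (ln (INR (S (S n))) - ln (INR (S n)) <= / INR (S n))%R).
{ intros n.
  pose proof (lt_0_INR (S n) ltac:(lia)) as P.
  rewrite (S_INR (S n)).
  replace (INR (S n) + 1)%R with (INR (S n) * (1 + / INR (S n)))%R by (field; lra).
  assert (0 < / INR (S n))%R by now apply Rinv_0_lt_compat.
  rewrite ln_mult by lra.
  assert (ln (1 + / INR (S n)) <= / INR (S n))%R.
  { rewrite <- (ln_exp (/ INR (S n))) at 2. apply ln_le; [lra|].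
    apply Rlt_le, exp_ineq1; lra. }
  lra. }
assert (Hlow : forall n, (u N - k * ln (INR (S N)) + k * ln (INR (S (N + n)))
   <= u (n + N)%nat)%R).
{ induction n as [|n IH].
  - rewrite Nat.add_0_r; simpl (0 + N)%nat; lra.
  - specialize (Hu (n + N)%nat ltac:(lia)); specialize (Hln (n + N)%nat).
    replace (N + S n)%nat with (S (n + N)) by lia.
    replace (N + n)%nat with (n + N)%nat in IH by lia.
    change (S n + N)%nat with (S (n + N)).
    apply (Rmult_le_compat_l k) in Hln; [|lra].
    unfold Rdiv in Hu; lra. }
apply is_lim_seq_incr_n with N.
apply is_lim_seq_le_p_loc with
  (fun n => u N - k * ln (INR (S N)) + k * ln (INR (S (N + n))))%R.
- exists 0%nat; intros n _; apply Hlow.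
- apply is_lim_seq_plus with (u N - k * ln (INR (S N)))%R p_infty;
    [apply is_lim_seq_const | | reflexivity].
  replace p_infty with (Rbar_mult k p_infty).
  2:{ simpl; destruct (Rle_dec 0 k) as [h|h]; [|lra].
      destruct (Rle_lt_or_eq_dec 0 k h); [reflexivity|lra]. }
  apply is_lim_seq_scal_l.
  apply (filterlim_comp _ _ _ (fun n => INR (S (N + n))) ln _ (Rbar_locally p_infty)).
  + apply is_lim_seq_ext with (fun n => INR (n + S N)).
    * intros n; f_equal; lia.
    * apply (is_lim_seq_incr_n INR (S N)), is_lim_seq_INR.
  + apply is_lim_ln_p.
Qed.

(** * Continued fractions whose partial denominators have positive real part *)

Notation cnum b := (cf_num (fun _ => RtoC 1) b).
Notation cden b := (cf_den (fun _ => RtoC 1) b).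
Notation cconv b := (cf_convergent (fun _ => RtoC 1) b).

Lemma num_SS b n : cnum b (S (S n)) = b (S (S n)) * cnum b (S n) + cnum b n.
Proof. change (cnum b (S (S n))) with (b (S (S n)) * cnum b (S n) + 1 * cnum b n); ring. Qed.

Lemma den_SS b n : cden b (S (S n)) = b (S (S n)) * cden b (S n) + cden b n.
Proof. change (cden b (S (S n))) with (b (S (S n)) * cden b (S n) + 1 * cden b n); ring. Qed.

Lemma cf_ext (b b' : nat -> C) : (forall n, b n = b' n) ->
  forall n, cnum b n = cnum b' n /\ cden b n = cden b' n.
Proof.
intros H.
assert (G : forall n, (cnum b n = cnum b' n /\ cden b n = cden b' n) /\
                      (cnum b (S n) = cnum b' (S n) /\ cden b (S n) = cden b' (S n))).
{ induction n as [|n [[A1 A2] [A3 A4]]].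
  - simpl; now rewrite !H.
  - split; [now split|]. now rewrite !num_SS, !den_SS, H, A1, A2, A3, A4. }
intros n; apply G.
Qed.

Lemma determinant_formula b n :
  cnum b (S n) * cden b n - cnum b n * cden b (S n) = (- (1)) ^ n.
Proof.
induction n as [|n IH].
- simpl; ring.
- rewrite num_SS, den_SS, Cpow_S, <- IH; ring.
Qed.

Lemma conv_step2 b n : cden b n <> 0 -> cden b (S (S n)) <> 0 ->
  cconv b (S (S n)) - cconv b n
  = b (S (S n)) * (- (1)) ^ n / (cden b (S (S n)) * cden b n).
Proof.
intros H0 H2; unfold cf_convergent.
rewrite <- (determinant_formula b n), num_SS.
rewrite den_SS in *; field; auto.
Qed.

(** For positive real [b] this is the product of two consecutive denominators,
    the denominator of the difference of two convergents.  The real part keeps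
    it increasing in [n] when the denominators are complex. *)
Definition growth b n : R := Re (cden b (S n) * Cconj (cden b n)).

Lemma growth_S b n :
  growth b (S n) = (growth b n + Re (b (S (S n))) * Cmod (cden b (S n)) ^ 2)%R.
Proof.
unfold growth; rewrite den_SS, Cmod2_alt.
generalize (b (S (S n))) (cden b (S n)) (cden b n); intros [x1 x2] [y1 y2] [z1 z2].
simpl; ring.
Qed.

Lemma growth_le_Cmod b n : (growth b n <= Cmod (cden b (S n)) * Cmod (cden b n))%R.
Proof.
unfold growth; rewrite <- (Cmod_conj (cden b n)), <- Cmod_mult.
eapply Rle_trans; [apply Rle_abs | apply re_le_Cmod].
Qed.

Lemma growth_0 b : growth b 0 = Re (b 1%nat).
Proof. unfold growth; simpl; destruct (b 1%nat); simpl; ring. Qed.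

Lemma growth_incr b : (forall n, (0 < Re (b (S n)))%R) ->
  forall n, (growth b n <= growth b (S n))%R.
Proof.
intros H n; rewrite growth_S.
specialize (H (S n)); pose proof (pow2_ge_0 (Cmod (cden b (S n)))); nra.
Qed.

Lemma growth_pos b : (forall n, (0 < Re (b (S n)))%R) -> forall n, (0 < growth b n)%R.
Proof.
intros H; induction n as [|n IH].
- rewrite growth_0; apply H.
- pose proof (growth_incr b H n); lra.
Qed.

Lemma den_pos b : (forall n, (0 < Re (b (S n)))%R) -> forall n, (0 < Cmod (cden b n))%R.
Proof.
intros H n; pose proof (growth_pos b H n); pose proof (growth_le_Cmod b n).
pose proof (Cmod_ge_0 (cden b n)); pose proof (Cmod_ge_0 (cden b (S n))).
destruct (Rle_lt_or_eq_dec 0 (Cmod (cden b n))) as [h|h]; auto.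
rewrite <- h in *; lra.
Qed.

Lemma den_neq0 b : (forall n, (0 < Re (b (S n)))%R) -> forall n, cden b n <> 0.
Proof. intros H n; apply Cmod_gt_0, den_pos, H. Qed.

Lemma Re_pos_neq0 z : (0 < Re z)%R -> z <> 0.
Proof. intros H E; rewrite E in H; simpl in H; lra. Qed.

(** The recurrence for [growth] turns the right-hand side into
    Re(b_{n+2}) |B_{n+1}|^2 / (g_n g_{n+1}), and g_n <= |B_{n+1} B_n|.  The bound
    is read in two ways: it makes the even convergents of bounded variation,
    and it prevents the denominators from being too small. *)
Lemma den_gap_le_inv_growth b n : (forall n, (0 < Re (b (S n)))%R) ->
  (Re (b (S (S n))) / (Cmod (cden b (S (S n))) * Cmod (cden b n))
   <= / growth b n - / growth b (S n))%R.
Proof.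
intros H.
pose proof (growth_pos b H n) as P0; pose proof (growth_pos b H (S n)) as P1.
pose proof (growth_le_Cmod b n) as L0; pose proof (growth_le_Cmod b (S n)) as L1.
pose proof (den_pos b H n) as D0; pose proof (den_pos b H (S n)) as D1.
pose proof (den_pos b H (S (S n))) as D2.
replace (/ growth b n - / growth b (S n))%R
  with ((growth b (S n) - growth b n) / (growth b n * growth b (S n)))%R by (field; lra).
rewrite (growth_S b n) at 1.
set (x := Cmod (cden b n)) in *; set (y := Cmod (cden b (S n))) in *.
set (z := Cmod (cden b (S (S n)))) in *; set (r := Re (b (S (S n)))).
replace (growth b n + r * y ^ 2 - growth b n)%R with (r * y ^ 2)%R by ring.
assert (0 < r)%R by apply H.
replace (r / (z * x))%R with (r * y ^ 2 / ((y * x) * (z * y)))%R by (field; lra).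
apply Rmult_le_compat_l; [nra|].
apply Rinv_le_contravar; [nra|].
apply Rmult_le_compat; lra.
Qed.

Lemma conv_step2_le b K n : (forall n, (0 < Re (b (S n)))%R) ->
  (Cmod (b (S (S n))) <= K * Re (b (S (S n))))%R ->
  (Cmod (cconv b (S (S n)) - cconv b n) <= K * (/ growth b n - / growth b (S n)))%R.
Proof.
intros H HK.
pose proof (den_pos b H n) as D0; pose proof (den_pos b H (S (S n))) as D2.
pose proof (H (S n)) as Hr.
assert (HK0 : (0 <= K)%R).
{ pose proof (Cmod_ge_0 (b (S (S n)))).
  destruct (Rle_or_lt 0 K); auto; nra. }
rewrite conv_step2 by now apply den_neq0.
rewrite Cmod_div, !Cmod_mult, Cmod_pow, Cmod_m1, pow1, Rmult_1_r
  by (apply Cmult_neq_0; now apply den_neq0).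
eapply Rle_trans; [|apply Rmult_le_compat_l; [exact HK0 | now apply den_gap_le_inv_growth]].
unfold Rdiv; rewrite <- Rmult_assoc; apply Rmult_le_compat_r; [|exact HK].
apply Rlt_le, Rinv_0_lt_compat; nra.
Qed.

Lemma conv_step_le b n : (forall n, (0 < Re (b (S n)))%R) ->
  (Cmod (cconv b (S n) - cconv b n) <= / growth b n)%R.
Proof.
intros H.
unfold cf_convergent.
replace (cnum b (S n) / cden b (S n) - cnum b n / cden b n)
  with ((- (1)) ^ n / (cden b (S n) * cden b n)).
2:{ rewrite <- (determinant_formula b n); field; split; now apply den_neq0. }
rewrite Cmod_div, Cmod_mult, Cmod_pow, Cmod_m1, pow1
  by (apply Cmult_neq_0; now apply den_neq0).
unfold Rdiv; rewrite Rmult_1_l; apply Rinv_le_contravar;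
  [now apply growth_pos | apply growth_le_Cmod].
Qed.

Lemma double_S n : (2 * S n)%nat = S (S (2 * n)).
Proof. lia. Qed.

(** The hypothesis on [K] says that the even partial denominators stay in a
    fixed sector around the positive real axis; it lets the telescoping bound,
    which involves Re(b_{2n}), control |b_{2n}|. *)
Lemma even_convergents_bounded_limit b K : (forall n, (0 < Re (b (S n)))%R) ->
  b 0%nat = 0 -> (0 <= K)%R ->
  (forall n, (Cmod (b (2 * S n)%nat) <= K * Re (b (2 * S n)%nat))%R) ->
  exists l, is_C_lim_seq (fun n => cconv b (2 * n)) l /\ (Cmod l <= K / Re (b 1%nat))%R.
Proof.
intros H H0 K0 HK.
destruct (is_C_lim_seq_bounded_variation (fun n => cconv b (2 * n))
  (fun n => K * / growth b (2 * n))%R) as [l [Hl Bl]].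
- intros n; apply Rmult_le_pos; auto; apply Rlt_le, Rinv_0_lt_compat; now apply growth_pos.
- intros n; rewrite double_S.
  specialize (HK n); rewrite double_S in HK.
  eapply Rle_trans; [apply (conv_step2_le b K); assumption|].
  rewrite Rmult_minus_distr_l; apply Rplus_le_compat_l, Ropp_le_contravar.
  apply Rmult_le_compat_l; auto.
  apply Rinv_le_contravar; [now apply growth_pos | now apply growth_incr].
- exists l; split; [exact Hl|].
  change (2 * 0)%nat with 0%nat in Bl; rewrite growth_0 in Bl.
  replace l with (l - cconv b 0); [exact Bl|].
  unfold cf_convergent; simpl; rewrite H0; field.
Qed.

(** Consecutive convergents differ by 1 / |B_{n+1} B_n| <= 1 / g_n. *)
Lemma conv_converges b l : (forall n, (0 < Re (b (S n)))%R) ->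
  is_lim_seq (fun n => growth b (2 * n)) p_infty ->
  is_C_lim_seq (fun n => cconv b (2 * n)) l ->
  is_C_lim_seq (cconv b) l.
Proof.
intros H Hg Hl; apply is_C_lim_seq_even_odd; [exact Hl|].
apply is_C_lim_seq_le
  with (fun n => / growth b (2 * n) + Cmod (cconv b (2 * n) - l))%R.
- intros n.
  replace (cconv b (S (2 * n)) - l)
    with ((cconv b (S (2 * n)) - cconv b (2 * n)) + (cconv b (2 * n) - l)) by ring.
  eapply Rle_trans; [apply Cmod_triangle|].
  apply Rplus_le_compat_r; now apply conv_step_le.
- replace (Finite 0) with (Finite (0 + 0)) by (f_equal; ring).
  apply is_lim_seq_plus'; [|now apply is_C_lim_seq_Cmod in Hl].
  change (Finite 0) with (Rbar_inv p_infty).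
  now apply is_lim_seq_inv.
Qed.

(** * The partial denominators of the theorem *)

Definition coef (M : C) (n : nat) : C :=
  match n with
  | O => 0
  | S _ => if Nat.odd n then M + 1 else M / INR (Nat.div2 n) ^ 2
  end.

Lemma coef_odd M n : coef M (S (2 * n)) = M + 1.
Proof.
unfold coef; rewrite Nat.odd_succ, Nat.even_mul; reflexivity.
Qed.

Lemma coef_even M n : coef M (S (S (2 * n))) = M / INR (S n) ^ 2.
Proof.
rewrite <- double_S; unfold coef.
rewrite Nat.odd_mul, Nat.div2_double, double_S; reflexivity.
Qed.

Lemma RtoC_neq0 x : x <> 0%R -> RtoC x <> 0.
Proof. intros H E; apply H; now apply RtoC_inj. Qed.

Lemma INR_S_pos n : (0 < INR (S n))%R.
Proof. apply lt_0_INR; lia. Qed.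

Lemma INR_S_neq0 n : RtoC (INR (S n)) <> 0.
Proof. apply RtoC_neq0; pose proof (INR_S_pos n); lra. Qed.

Lemma coef_even_scal M n : coef M (S (S (2 * n))) = M * RtoC (/ INR (S n) ^ 2).
Proof.
rewrite coef_even; unfold Cdiv.
rewrite RtoC_inv, RtoC_pow; [reflexivity|].
apply pow_nonzero; pose proof (INR_S_pos n); lra.
Qed.

Lemma Re_coef_even M n : Re (coef M (S (S (2 * n)))) = (Re M / INR (S n) ^ 2)%R.
Proof. now rewrite coef_even_scal, re_scal_r. Qed.

Lemma Re_coef_odd M n : Re (coef M (S (2 * n))) = (Re M + 1)%R.
Proof. rewrite coef_odd; reflexivity. Qed.

Lemma coef_Re_pos M : (0 < Re M)%R -> forall n, (0 < Re (coef M (S n)))%R.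
Proof.
intros H n; destruct (Nat.Even_or_Odd n) as [[k Hk] | [k Hk]]; subst n.
- rewrite Re_coef_odd; lra.
- replace (2 * k + 1)%nat with (S (2 * k)) by lia.
  rewrite Re_coef_even; apply Rdiv_lt_0_compat; auto.
  apply pow_lt, INR_S_pos.
Qed.

(** Even partial denominators are positive multiples of M. *)
Lemma coef_sector M : (0 < Re M)%R -> forall n,
  Cmod (coef M (2 * S n)) = (Cmod M / Re M * Re (coef M (2 * S n)))%R.
Proof.
intros H n; rewrite double_S, Re_coef_even, coef_even_scal, Cmod_mult, Cmod_R.
pose proof (INR_S_pos n).
rewrite Rabs_pos_eq by (apply Rlt_le, Rinv_0_lt_compat, pow_lt; auto).
field; lra.
Qed.

Lemma coef_even_convergents_limit M : (0 < Re M)%R -> exists l,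
  is_C_lim_seq (fun n => cconv (coef M) (2 * n)) l /\
  (Cmod l <= Cmod M / Re M / (Re M + 1))%R.
Proof.
intros H.
destruct (even_convergents_bounded_limit (coef M) (Cmod M / Re M)) as [l [Hl Bl]].
- now apply coef_Re_pos.
- reflexivity.
- apply Rmult_le_pos; [apply Cmod_ge_0 | now apply Rlt_le, Rinv_0_lt_compat].
- intros n; rewrite coef_sector; auto; apply Rle_refl.
- exists l; split; auto.
Qed.

(** Over two steps the growth is (Re M + 1) |B_{2n+2}|^2 + Re M |B_{2n+1}|^2 / (n+1)^2.
    By the inequality of the two means this is at least a multiple of
    |B_{2n+2} B_{2n+1}| / (n+1), hence of 1 / (n+1). *)
Lemma growth_even_diverges M : (0 < Re M)%R ->
  is_lim_seq (fun n => growth (coef M) (2 * n)) p_infty.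
Proof.
intros H.
pose proof (coef_Re_pos M H) as P.
apply is_lim_seq_harmonic_increments with (2 * Re M * growth (coef M) 0)%R 0%nat.
- pose proof (growth_pos _ P 0); nra.
- intros n _. rewrite double_S, !growth_S, Re_coef_even.
  rewrite <- double_S, Re_coef_odd.
  set (x := Cmod (cden (coef M) (S (2 * n)))).
  set (y := Cmod (cden (coef M) (2 * S n))).
  pose proof (INR_S_pos n) as Hk; set (k := INR (S n)) in *.
  assert (Hxy : (growth (coef M) 0 <= x * y)%R).
  { apply Rle_trans with (growth (coef M) (S (2 * n))).
    - generalize (S (2 * n)); induction n0; [lra|].
      pose proof (growth_incr _ P n0); lra.
    - unfold x, y; rewrite double_S, Rmult_comm; apply growth_le_Cmod. }
  assert (0 <= x)%R by apply Cmod_ge_0; assert (0 <= y)%R by apply Cmod_ge_0.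
  (* the completed square behind the inequality of the two means *)
  assert (E : (Re M / k ^ 2 * x ^ 2 + Re M * y ^ 2
     = Re M * (x / k - y) ^ 2 + 2 * Re M * (x * y) / k)%R) by (field; lra).
  assert (0 <= Re M * (x / k - y) ^ 2)%R
    by (apply Rmult_le_pos; [lra | apply pow2_ge_0]).
  assert (2 * Re M * growth (coef M) 0 / k <= 2 * Re M * (x * y) / k)%R.
  { apply Rmult_le_compat_r; [now apply Rlt_le, Rinv_0_lt_compat|].
    apply Rmult_le_compat_l; lra. }
  nra.
Qed.

(** * Contiguous relations between the parameters M and M + 1 *)

(** The recurrences for M and M + 1 have contiguous hypergeometric solutions:
    B_{2n} is the terminating series 3F2(-n, -M, M+1; 1, 1; 1), and series whose
    parameters differ by integers satisfy linear relations.  Here [x] solves the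
    recurrence for M and [z] the one for M + 1; since both are determined by
    two initial values, relations compatible with the recurrences need only be
    checked at the start. *)
Lemma contiguous_relations M (x z : nat -> C) :
  (forall n, x (S (S n)) = coef M (S (S n)) * x (S n) + x n) ->
  (forall n, z (S (S n)) = coef (M + 1) (S (S n)) * z (S n) + z n) ->
  (M + 1) * x 0%nat = 2 * z 1%nat - (M + 3) * z 0%nat ->
  M * x 1%nat = 2 * z 0%nat + (M - 1) * z 1%nat ->
  forall n,
  (M + 1) * x (2 * n)%nat
    = 2 * z (S (2 * n)) - (M + 3 + 2 * INR n) * z (2 * n)%nat /\
  M * x (S (2 * n))
    = 2 * INR (S n) ^ 2 * z (2 * n)%nat
      + (M + 1 - 2 * INR (S n)) * z (S (2 * n)).
Proof.
intros Hx Hz H0 H1; induction n as [|n [IH0 IH1]].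
- change (2 * 0)%nat with 0%nat; simpl INR; split.
  + rewrite H0; ring.
  + rewrite H1; ring.
- pose proof (INR_S_neq0 n) as Hk.
  rewrite double_S, (Hx (S (2 * n))), (Hz (S (2 * n))), (Hx (2 * n)%nat), (Hz (2 * n)%nat).
  rewrite !coef_even, <- !double_S, !coef_odd.
  rewrite (S_INR (S n)), RtoC_plus; rewrite S_INR, RtoC_plus in *.
  set (k := RtoC (INR n)) in *.
  set (x0 := x (2 * n)%nat) in *; set (z0 := z (2 * n)%nat) in *.
  set (x1 := x (S (2 * n))) in *; set (z1 := z (S (2 * n))) in *.
  (* the second relation at n + 1 follows from this first one and the second
     relation at n, through x_{2n+3} = (M+1) x_{2n+2} + x_{2n+1} *)
  assert (E : (M + 1) * (M / (k + 1) ^ 2 * x1 + x0)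
   = 2 * ((M + 1 + 1) * ((M + 1) / (k + 1) ^ 2 * z1 + z0) + z1)
     - (M + 3 + 2 * (k + 1)) * ((M + 1) / (k + 1) ^ 2 * z1 + z0)).
  { replace ((M + 1) * (M / (k + 1) ^ 2 * x1 + x0))
      with ((M + 1) / (k + 1) ^ 2 * (M * x1) + (M + 1) * x0) by (field; auto).
    rewrite IH0, IH1; field; auto. }
  split; [exact E|].
  replace (M * ((M + 1) * (M / (k + 1) ^ 2 * x1 + x0) + x1))
    with (M * ((M + 1) * (M / (k + 1) ^ 2 * x1 + x0)) + M * x1) by ring.
  rewrite E, IH1; field; auto.
Qed.

Lemma Re_add1_pos M : (0 < Re M)%R -> (0 < Re (M + 1))%R.
Proof. intros H; rewrite re_plus, re_RtoC; lra. Qed.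

(** The contiguous relations hold for the denominators themselves.  For the
    numerators at M + 1, the partner at M must have the initial values
    2/(M+1) and (M-1)/M prescribed by the relations at n = 0, which makes it the
    combination of A and B below.  Cross-multiplying the first relation for the
    numerators with that for the denominators leaves the determinant formula at
    M + 1. *)
Lemma shift_even_convergents M n : (0 < Re M)%R ->
  / (cden (coef M) (2 * n) * cden (coef (M + 1)) (2 * n))
  = 1 + - ((M + 1) ^ 2 / (2 * M)) * cconv (coef M) (2 * n)
      + - ((M + 1) / 2) * cconv (coef (M + 1)) (2 * n).
Proof.
intros H.
pose proof (Re_pos_neq0 M H) as HM.
pose proof (Re_add1_pos M H) as Ha; pose proof (Re_pos_neq0 _ Ha) as HM1.
destruct (contiguous_relations M (fun n => cden (coef M) n) (fun n => cden (coef (M + 1)) n)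
  (den_SS _) (den_SS _)) with n as [LB _].
{ simpl; ring. }
{ simpl; ring. }
destruct (contiguous_relations M
  (fun n => 2 / (M + 1) * cden (coef M) n - (M + 1) / M * cnum (coef M) n)
  (fun n => cnum (coef (M + 1)) n)) with n as [LA _].
{ intros k; rewrite den_SS, num_SS; ring. }
{ apply num_SS. }
{ simpl; field; auto. }
{ simpl; field; auto. }
pose proof (determinant_formula (coef (M + 1)) (2 * n)) as W.
pose proof (den_neq0 _ (coef_Re_pos M H) (2 * n)) as Hq.
pose proof (den_neq0 _ (coef_Re_pos _ Ha) (2 * n)) as Hq'.
assert (Hs : (- (1)) ^ (2 * n) = RtoC 1).
{ clear; induction n as [|n IH]; [reflexivity|].
  rewrite double_S, !Cpow_S, IH; ring. }
rewrite Hs in W.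
unfold cf_convergent.
cbv beta in LA, LB.
set (q := cden (coef M) (2 * n)) in *; set (q' := cden (coef (M + 1)) (2 * n)) in *.
set (u' := cden (coef (M + 1)) (S (2 * n))) in *.
set (p := cnum (coef M) (2 * n)) in *; set (p' := cnum (coef (M + 1)) (2 * n)) in *.
set (t' := cnum (coef (M + 1)) (S (2 * n))) in *.
assert (E : (M + 1) * (2 / (M + 1) * q - (M + 1) / M * p) * q' - (M + 1) * q * p' = 2).
{ rewrite LA, LB.
  transitivity (2 * (t' * q' - p' * u')); [ring | rewrite W; ring]. }
replace (/ (q * q')) with (2 / (2 * (q * q'))) by (field; auto).
rewrite <- E at 1; field; auto.
Qed.

Lemma Re_inv_pos z : (0 < Re z)%R -> (0 < Re (/ z))%R.
Proof.
destruct z as [x y]; simpl; intros H.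
apply Rdiv_lt_0_compat; nra.
Qed.

(** The ratio v_n on the right satisfies v_0 = M and
    v_{n+1} = M + 1 / ((M+1)/(n+1)^2 + 1/v_n).  So the factor M / (M+1) amounts
    to an equivalence transformation of the continued fraction of B_{2n+1}/B_{2n},
    one whose partial denominators again have positive real part. *)
Lemma den_ratio_Re M n : (0 < Re M)%R ->
  (Re M <= Re (M / (M + 1) * (cden (coef M) (S (2 * n)) / cden (coef M) (2 * n))))%R.
Proof.
intros H.
pose proof (Re_pos_neq0 M H) as HM.
pose proof (Re_add1_pos M H) as Ha; pose proof (Re_pos_neq0 _ Ha) as HM1.
pose proof (den_neq0 _ (coef_Re_pos M H)) as Hden.
induction n as [|n IH].
- apply Req_le; f_equal; simpl; field; auto.
- pose proof (INR_S_neq0 n) as Hk.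
  set (v := M / (M + 1) * _) in IH.
  assert (Hv : (0 < Re v)%R) by lra.
  assert (Hw : (0 < Re ((M + 1) / RtoC (INR (S n)) ^ 2 + / v))%R).
  { rewrite re_plus; apply Rplus_lt_0_compat; [|now apply Re_inv_pos].
    replace ((M + 1) / RtoC (INR (S n)) ^ 2) with (coef (M + 1) (S (S (2 * n))))
      by apply coef_even.
    now apply coef_Re_pos. }
  match goal with |- (_ <= Re ?z)%R =>
    replace z with (M + / ((M + 1) / RtoC (INR (S n)) ^ 2 + / v)) end.
  { rewrite re_plus; apply Re_inv_pos in Hw; lra. }
  assert (H2 := Hden (2 * S n)%nat); rewrite double_S in H2.
  apply Re_pos_neq0 in Hw.
  pose proof (Hden (2 * n)%nat) as H0; pose proof (Hden (S (2 * n))) as H1.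
  rewrite double_S, (den_SS _ (S (2 * n))), <- double_S, coef_odd, double_S.
  rewrite den_SS, coef_even in *.
  unfold v in *.
  set (u := cden (coef M) (S (2 * n))) in *; set (q := cden (coef M) (2 * n)) in *.
  set (k := RtoC (INR (S n))) in *.
  assert (HD : M * u + q * k ^ 2 <> 0).
  { intros E; apply H2.
    replace (M / k ^ 2 * u + q) with ((M * u + q * k ^ 2) / k ^ 2) by (field; auto).
    rewrite E; field; auto. }
  field; repeat split; auto.
  match goal with |- ?z <> _ =>
    replace z with ((M + 1) * (M * u + q * k ^ 2)) by ring end.
  now apply Cmult_neq_0.
Qed.

(** Solving the contiguous relations for B'_{2n} gives
    (M+1) B'_{2n} / B_{2n} = 2 v_n + 2n + 1 - M with v_n as in [den_ratio_Re], whose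
    real part is at least 2n + 1 + Re M. *)
Lemma den_shift_growth M n : (0 < Re M)%R ->
  (INR (S n) * Cmod (cden (coef M) (2 * n))
   <= Cmod (M + 1) * Cmod (cden (coef (M + 1)) (2 * n)))%R.
Proof.
intros H.
pose proof (Re_pos_neq0 M H) as HM.
pose proof (Re_add1_pos M H) as Ha; pose proof (Re_pos_neq0 _ Ha) as HM1.
pose proof (den_ratio_Re M n H) as Hv.
pose proof (den_neq0 _ (coef_Re_pos M H) (2 * n)) as Hq.
destruct (contiguous_relations M (fun n => cden (coef M) n) (fun n => cden (coef (M + 1)) n)
  (den_SS _) (den_SS _)) with n as [L0 L1].
{ simpl; ring. }
{ simpl; ring. }
cbv beta in L0, L1.
set (v := M / (M + 1) * _) in Hv.
rewrite <- !Cmod_mult.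
assert (E : (M + 1) * cden (coef (M + 1)) (2 * n)
  = (2 * v + RtoC (2 * INR n + 1) - M) * cden (coef M) (2 * n)).
{ unfold v; rewrite S_INR in L1; rewrite RtoC_plus in *; rewrite RtoC_mult.
  set (k := RtoC (INR n)) in *.
  set (q := cden (coef M) (2 * n)) in *; set (q' := cden (coef (M + 1)) (2 * n)) in *.
  set (u := cden (coef M) (S (2 * n))) in *; set (u' := cden (coef (M + 1)) (S (2 * n))) in *.
  replace ((2 * (M / (M + 1) * (u / q)) + (2 * k + 1) - M) * q)
    with (2 / (M + 1) * (M * u) + (2 * k + 1 - M) / (M + 1) * ((M + 1) * q))
    by (field; auto).
  rewrite L1, L0; field; auto. }
rewrite E, Cmod_mult.
apply Rmult_le_compat_r; [apply Cmod_ge_0|].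
eapply Rle_trans; [|apply re_le_Cmod].
eapply Rle_trans; [|apply Rle_abs].
unfold Cminus.
rewrite !re_plus, re_opp, re_scal_l, re_RtoC, S_INR.
pose proof (pos_INR n); lra.
Qed.

(** If the limit were not 0, then |B_{2n} B'_{2n}| would be bounded, and by
    [den_shift_growth] so would (n+1) |B_{2n}|^2.  The decrease of 1 / g_{2n} would
    then be bounded below by a harmonic series, but 1 / g_{2n} is positive. *)
Lemma shift_gap_vanishes M E : (0 < Re M)%R ->
  is_C_lim_seq
    (fun n => / (cden (coef M) (2 * n) * cden (coef (M + 1)) (2 * n))) E ->
  E = 0.
Proof.
intros H HE.
destruct (Ceq_dec E 0) as [|NE]; [assumption|exfalso].
apply Cmod_gt_0 in NE.
pose proof (coef_Re_pos M H) as P.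
pose proof (coef_Re_pos _ (Re_add1_pos M H)) as P'.
apply is_C_lim_seq_Cmod, is_lim_seq_spec in HE.
assert (Hd : (0 < Cmod E / 2)%R) by lra.
destruct (HE (mkposreal _ Hd)) as [N HN]; simpl in HN.
set (K := (Cmod (M + 1) * / (Cmod E / 2))%R).
assert (HK : (0 < K)%R).
{ apply Rmult_lt_0_compat; [|now apply Rinv_0_lt_compat].
  apply Cmod_gt_0, Re_pos_neq0, Re_add1_pos, H. }
(* beyond N the gap exceeds |E| / 2 *)
assert (Hq : forall n, (N <= n)%nat ->
   (INR (S n) * Cmod (cden (coef M) (2 * n)) ^ 2 <= K)%R).
{ intros n Hn; specialize (HN n Hn).
  rewrite Rminus_0_r, Rabs_pos_eq in HN by apply Cmod_ge_0.
  pose proof (den_pos _ P (2 * n)) as D; pose proof (den_pos _ P' (2 * n)) as D'.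
  pose proof (den_shift_growth M n H) as G.
  assert (Cmod E / 2 <= / (Cmod (cden (coef M) (2 * n)) * Cmod (cden (coef (M + 1)) (2 * n))))%R.
  { rewrite <- Cmod_mult, <- Cmod_inv
      by (apply Cmult_neq_0; apply den_neq0; assumption).
    set (w := / _) in *.
    pose proof (Cmod_triangle w (- (w - E))) as T; rewrite Cmod_opp in T.
    replace (w + - (w - E)) with E in T by ring.
    apply Rlt_le in HN; lra. }
  set (x := Cmod (cden (coef M) (2 * n))) in *.
  set (x' := Cmod (cden (coef (M + 1)) (2 * n))) in *.
  apply Rle_trans with (Cmod (M + 1) * (x * x'))%R.
  - simpl (x ^ 2)%R; nra.
  - apply Rmult_le_compat_l; [apply Cmod_ge_0|].
    rewrite <- (Rinv_inv (x * x')).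
    apply Rinv_le_contravar; assumption. }
assert (HL : is_lim_seq (fun n => - / growth (coef M) (2 * n))%R p_infty).
{ apply is_lim_seq_harmonic_increments with (Re M / K)%R N;
    [now apply Rdiv_lt_0_compat|].
  intros n Hn.
  pose proof (Hq n Hn) as Q0; pose proof (Hq (S n) ltac:(lia)) as Q1.
  pose proof (den_gap_le_inv_growth (coef M) (2 * n) P) as T.
  rewrite Re_coef_even in T.
  rewrite double_S in *.
  assert (/ growth (coef M) (S (S (2 * n))) <= / growth (coef M) (S (2 * n)))%R
    by (apply Rinv_le_contravar; [now apply growth_pos | now apply growth_incr]).
  refine (Rle_trans _ _ _ _ (Rle_trans _ _ _ T _)); [|lra].
  pose proof (den_pos _ P (2 * n)) as D0; pose proof (den_pos _ P (S (S (2 * n)))) as D1.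
  set (x := Cmod (cden (coef M) (2 * n))) in *.
  set (y := Cmod (cden (coef M) (S (S (2 * n))))) in *.
  pose proof (INR_S_pos n) as Hk; rewrite (S_INR (S n)) in Q1; set (k := INR (S n)) in *.
  assert (Hxy : (k * (y * x) <= K)%R) by nra.
  replace (Re M / K / k)%R with (Re M / k * / K)%R by (field; lra).
  replace (Re M / k ^ 2 / (y * x))%R with (Re M / k * / (k * (y * x)))%R by (field; lra).
  apply Rmult_le_compat_l; [apply Rlt_le, Rdiv_lt_0_compat; lra|].
  apply Rinv_le_contravar; [|exact Hxy].
  apply Rmult_lt_0_compat; nra. }
apply (is_lim_seq_le _ (fun _ => 0%R) p_infty 0) in HL; [exact HL| |apply is_lim_seq_const].
intros n; pose proof (Rinv_0_lt_compat _ (growth_pos _ P (2 * n))); lra.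
Qed.

(** * The functional equation and the series *)

(** This is f(M) / (2M), to be identified with Phi(-1,2,M+1).  Only even
    convergents are used, because the functional equation lives on them. *)
Definition half_value (M : C) : C :=
  C_Lim_seq (fun n => cconv (coef M) (2 * n)) / (2 * M).

Lemma half_value_spec M : (0 < Re M)%R ->
  is_C_lim_seq (fun n => cconv (coef M) (2 * n)) (2 * M * half_value M).
Proof.
intros H; destruct (coef_even_convergents_limit M H) as [l [Hl _]].
unfold half_value; rewrite (is_C_lim_seq_unique _ _ Hl).
replace (2 * M * (l / (2 * M))) with l; [exact Hl|].
field; now apply Re_pos_neq0.
Qed.

(** The bound |f(M)| <= |M| / (Re M (Re M + 1)) supplies the decay of f(M) / (2M)
    under M -> M + n that singles out the solution of the functional equation. *)
Lemma half_value_le M : (0 < Re M)%R ->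
  (Cmod (half_value M) <= / (2 * Re M * (Re M + 1)))%R.
Proof.
intros H; destruct (coef_even_convergents_limit M H) as [l [Hl Bl]].
unfold half_value; rewrite (is_C_lim_seq_unique _ _ Hl).
pose proof (Re_pos_neq0 _ H) as HM; pose proof (proj1 (Cmod_gt_0 M) HM) as HM'.
rewrite Cmod_div, Cmod_mult, Cmod_R, Rabs_pos_eq
  by (try lra; apply Cmult_neq_0; auto; apply RtoC_neq0; lra).
apply Rle_trans with (Cmod M / Re M / (Re M + 1) / (2 * Cmod M))%R.
- apply Rmult_le_compat_r; [apply Rlt_le, Rinv_0_lt_compat; lra | exact Bl].
- apply Req_le; field; lra.
Qed.

(** This is the limit of [shift_even_convergents], whose left-hand side vanishes
    by [shift_gap_vanishes]. *)
Lemma half_value_shift M : (0 < Re M)%R ->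
  half_value M + half_value (M + 1) = / (M + 1) ^ 2.
Proof.
intros H.
pose proof (Re_pos_neq0 M H) as HM.
pose proof (Re_add1_pos M H) as Ha; pose proof (Re_pos_neq0 _ Ha) as HM1.
pose proof (is_C_lim_seq_lin _ _ _ _ 1 (- ((M + 1) ^ 2 / (2 * M))) (- ((M + 1) / 2))
  (half_value_spec M H) (half_value_spec _ Ha)) as L.
apply (filterlim_ext _ (fun n => / (cden (coef M) (2 * n) * cden (coef (M + 1)) (2 * n))))
  in L; [|intros n; symmetry; now apply shift_even_convergents].
apply shift_gap_vanishes in L; [|assumption].
match type of L with ?e = _ =>
  replace (half_value M + half_value (M + 1)) with ((1 - e) / (M + 1) ^ 2) by (field; auto)
end.
rewrite L; field; auto.
Qed.

(** Iterating [half_value_shift] expresses the partial sums as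
    R(M) - (-1)^(n+1) R(M+n+1), and the last term tends to 0. *)
Lemma half_value_series M : (0 < Re M)%R ->
  is_C_lim_seq (sum_n (fun n => (- (1)) ^ n / (INR n + (M + 1)) ^ 2)) (half_value M).
Proof.
intros H.
assert (HRe : forall n, (Re (M + INR n) = Re M + INR n)%R)
  by (intros n; now rewrite re_plus, re_RtoC).
assert (Hp : forall n, (0 < Re (M + INR n))%R)
  by (intros n; rewrite HRe; pose proof (pos_INR n); lra).
assert (Hs : forall n, half_value (M + INR n)
   = / (INR n + (M + 1)) ^ 2 - half_value (M + INR (S n))).
{ intros n; rewrite S_INR, RtoC_plus, (Cplus_assoc M).
  replace (INR n + (M + 1)) with (M + INR n + 1) by ring.
  rewrite <- half_value_shift by apply Hp; ring. }
apply is_C_lim_seq_le with (fun n => / INR (S n))%R.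
- intros n.
  assert (E : sum_n (fun n => (- (1)) ^ n / (INR n + (M + 1)) ^ 2) n
    = half_value M - (- (1)) ^ S n * half_value (M + INR (S n))).
  { induction n as [|n IH].
    - rewrite sum_O.
      change ((- (1)) ^ 0 / (INR 0 + (M + 1)) ^ 2
        = half_value M - (- (1)) ^ 1 * half_value (M + INR 1)).
      rewrite <- (Cplus_0_r M) at 2; change (RtoC 0) with (RtoC (INR 0)).
      rewrite (Hs 0%nat); unfold Cdiv; simpl Cpow; ring.
    - rewrite sum_Sn, IH, (Hs (S n)), (Cpow_S _ (S n)).
      match goal with |- plus ?u ?v = _ => change (u + v = half_value M - 
         (- (1) * (- (1)) ^ S n * half_value (M + INR (S (S n))))) end.
      unfold Cdiv; ring. }
  rewrite E.
  replace (half_value M - (- (1)) ^ S n * half_value (M + INR (S n)) - half_value M)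
    with (- ((- (1)) ^ S n * half_value (M + INR (S n)))) by ring.
  rewrite Cmod_opp, Cmod_mult, Cmod_pow, Cmod_m1, pow1, Rmult_1_l.
  eapply Rle_trans; [apply half_value_le, Hp|].
  rewrite HRe; apply Rinv_le_contravar; [apply INR_S_pos|].
  rewrite S_INR; pose proof (pos_INR n); nra.
- apply (is_lim_seq_incr_1 (fun n => / INR n)%R).
  change (Finite 0) with (Rbar_inv p_infty).
  apply is_lim_seq_inv; [apply is_lim_seq_INR | discriminate].
Qed.

Theorem theorem2 :
  forall (M : C) (b : nat -> C),
    (0 < Re M)%R ->
    b 0%nat = 0%C ->
    (forall n : nat, (1 <= n)%nat -> b (2 * n - 1)%nat = (M + 1)%C) ->
    (forall n : nat, (1 <= n)%nat -> b (2 * n)%nat = (M / INR n ^ 2)%C) ->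
    ex_cf (fun _ => 1%C) b /\
    (2 * M * lerch (- (1)) 2 (M + 1))%C = CF (fun _ => 1%C) b.
Proof.
intros M b H H0 H1 H2.
assert (Hb : forall n, b n = coef M n).
{ intros [|n]; [exact H0|].
  destruct (Nat.Even_or_Odd n) as [[k Hk] | [k Hk]]; subst n.
  - rewrite coef_odd, <- (H1 (S k)) by lia; f_equal; lia.
  - replace (S (2 * k + 1)) with (S (S (2 * k))) by lia.
    rewrite coef_even, <- double_S; apply H2; lia. }
pose proof (coef_Re_pos M H) as P.
assert (Hc : is_C_lim_seq (cconv b) (2 * M * half_value M)).
{ apply (filterlim_ext (cconv (coef M))).
  - intros n; unfold cf_convergent; destruct (cf_ext _ _ Hb n) as [-> ->]; reflexivity.
  - apply conv_converges; auto.
    + now apply growth_even_diverges.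
    + now apply half_value_spec. }
split.
- exists (2 * M * half_value M); split; [|exact Hc].
  exists 0%nat; intros n _; destruct (cf_ext _ _ Hb n) as [_ ->]; now apply den_neq0.
- unfold CF; rewrite (is_C_lim_seq_unique _ _ Hc).
  unfold lerch, C_Series.
  now rewrite (is_C_lim_seq_unique _ _ (half_value_series M H)).
Qed.
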